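(* Let $n\ge1$ and let $Y_n=Y_n(C)$ be the real Bott manifold associated to a Bott matrix $C\in M_n(\mathbb Z_2)$. Then $Y_n$ is null-cobordant, i.e. $Y_n$ is diffeomorphic to the boundary of some compact smooth $(n+1)$-dimensional manifold with boundary.
   Context: A Bott matrix is a strictly upper triangular matrix $C=(c_{i,j})\in M_n(\mathbb Z_2)$. The associated real Bott manifold $Y_n(C)$ is the closed smooth $n$-manifold given by the real part of the smooth complete complex toric variety whose fan in $\mathbb R^n$ is as follows: choose integers $a_{i,j}$ ($i<j$) with $a_{i,j}\equiv c_{i,j}\bmod 2$, put $v_j=e_j$ and $v_{n+j}=-e_j+\sum_{k=j+1}^n a_{j,k}e_k$ for $1\le j\le n$; the cones are those generated by subsets of $\{v_1,\dots,v_{2n}\}$ containing no pair $\{v_i,v_{n+i}\}$. Equivalently, it is the small cover over the cube $I^n$: with facets $F_1,\dots,F_{2n}$ ($F_j$ and $F_{n+j}$ opposite), $\lambda(F_j)=e_j$ and $\lambda(F_{n+j})=e_j+\sum_{k=j+1}^n c_{j,k}e_k\in\mathbb Z_2^n$ for $1\le j\le n$, $Y_n(C)=(\mathbb Z_2^n\times I^n)/\!\sim$, where $(t,p)\sim(t',p')$ iff $p=p'$ and $t-t'$ lies in the span of the $\lambda(F)$ over the facets $F$ containing $p$. It is an iterated $\mathbb{RP}^1$-bundle. *)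

(* Defs.v *)
From HB Require Import structures.
From mathcomp Require Import all_boot all_order all_algebra.
From mathcomp Require Import all_classical all_reals all_analysis.
Set Implicit Arguments.
Unset Strict Implicit.
Unset Printing Implicit Defensive.
Import Order.TTheory GRing.Theory Num.Theory.
Import numFieldNormedType.Exports.
Local Open Scope classical_set_scope.
Local Open Scope ring_scope.

Section Smooth.
Context {R : realType} {m : nat}.
Implicit Types U D : set 'rV[R]_m.

(* All iterated partial derivatives of order at most k exist and are
   continuous at every point of U; only meant for U open. *)
Fixpoint Ck_on (k : nat) U (f : 'rV[R]_m -> R) : Prop :=
  (forall x, U x -> {for x, continuous f}) /\
  if k is k'.+1 then
    forall i : 'I_m, (forall x, U x -> derivable f x (delta_mx 0 i)) /\
                     Ck_on k' U (fun x => 'D_(delta_mx 0 i) f x)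
  else True.

Definition smooth_on U (l : nat) (g : 'rV[R]_m -> 'rV[R]_l) : Prop :=
  forall (j : 'I_l) (k : nat), Ck_on k U (fun x => g x 0 j).

(* For phi injective on D: the map F \o phi^-1 : phi @` D -> 'rV_l is smooth,
   i.e. near every point of phi @` D it is the restriction of a smooth map
   defined on an open subset of 'rV_m.  This is the usual notion both when
   phi @` D is open in 'rV_m and when it is only open in a half-space. *)
Definition smooth_in_coord (T : Type) (D : set T) (phi : T -> 'rV[R]_m)
    (l : nat) (F : T -> 'rV[R]_l) : Prop :=
  forall p, D p ->
    exists (N : set 'rV[R]_m) (g : 'rV[R]_m -> 'rV[R]_l),
      [/\ open N, N (phi p), smooth_on N g &
          forall q, D q -> N (phi q) -> F q = g (phi q)].

End Smooth.

(* A chart is a total function used only on its domain. *)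
Record chart (R : realType) (m : nat) (T : topologicalType) := Chart {
  chart_dom : set T;
  chart_map :> T -> 'rV[R]_m
}.

Record chartedSpace (R : realType) (m : nat) := ChartedSpace {
  carrier :> topologicalType;
  atlas : set (chart R m carrier)
}.
Arguments atlas {R m} c _ : rename.

Section Manifolds.
Context {R : realType}.

Definition half_space {n : nat} : set 'rV[R]_n.+1 := [set x | 0 <= x 0 0].

Record smooth_manifold_with_boundary (n : nat) (W : chartedSpace R n.+1) :
    Prop := {
  manifold_hausdorff : hausdorff_space W;
  manifold_second_countable : @second_countable W;
  manifold_cover :
    forall p : W, exists2 phi, atlas W phi & chart_dom phi p;
  (* each chart is a homeomorphism from an open set onto a relatively open
     subset of the half-space *)
  manifold_dom_open : forall phi, atlas W phi -> open (chart_dom phi);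
  manifold_continuous : forall phi, atlas W phi ->
    forall p, chart_dom phi p -> {for p, continuous phi};
  manifold_injective : forall phi, atlas W phi ->
    forall p q, chart_dom phi p -> chart_dom phi q -> phi p = phi q -> p = q;
  manifold_open_map : forall phi, atlas W phi ->
    forall V : set W, open V -> V `<=` chart_dom phi ->
    exists2 O : set 'rV[R]_n.+1, open O & phi @` V = O `&` half_space;
  manifold_transition : forall phi psi, atlas W phi -> atlas W psi ->
    smooth_in_coord (chart_dom phi `&` chart_dom psi) phi psi
}.

Definition boundary_set (n : nat) (W : chartedSpace R n.+1) : set W :=
  [set p | exists2 phi, atlas W phi & chart_dom phi p /\ phi p 0 0 = 0].
Arguments boundary_set {n} W _.

(* set_type (boundary_set W) carries the subspace topology. *)
Definition boundary_chart (n : nat) (W : chartedSpace R n.+1)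
    (phi : chart R n.+1 W) : chart R n (set_type (boundary_set W)) :=
  Chart [set p | chart_dom phi (set_val p)]
        (fun p => \row_(i < n) phi (set_val p) 0 (lift ord0 i)).

Definition boundary (n : nat) (W : chartedSpace R n.+1) : chartedSpace R n :=
  ChartedSpace (boundary_chart (W := W) @` atlas W).

Definition smooth_map (m l : nat) (X : chartedSpace R m)
    (Y : chartedSpace R l) (f : X -> Y) : Prop :=
  continuous f /\
  forall phi psi, atlas X phi -> atlas Y psi ->
    smooth_in_coord (chart_dom phi `&` f @^-1` chart_dom psi) phi (psi \o f).

Definition diffeomorphic (m : nat) (X Y : chartedSpace R m) : Prop :=
  exists (f : X -> Y) (g : Y -> X),
    [/\ cancel f g, cancel g f, smooth_map f & smooth_map g].

Definition null_cobordant (n : nat) (Y : chartedSpace R n) : Prop :=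
  exists W : chartedSpace R n.+1,
    [/\ smooth_manifold_with_boundary W, compact [set: W] &
        diffeomorphic Y (boundary W)].

End Manifolds.

Definition bott_matrix (n : nat) (C : 'M['F_2]_n) : Prop :=
  forall i j : 'I_n, (j <= i)%N -> C i j = 0.

Definition integral_lift (n : nat) (C : 'M['F_2]_n) (a : 'M[int]_n) : Prop :=
  forall i j : 'I_n, (i < j)%N -> (a i j)%:~R = C i j.

Section BottFan.
Context {n : nat}.
Implicit Types (a : 'M[int]_n) (s t r : {ffun 'I_n -> bool}).

(* v_j = e_j for b = false, v_(n+j) = - e_j + \sum_(k > j) a_(j,k) e_k for
   b = true; only the entries of a above the diagonal matter. *)
Definition bott_ray a (b : bool) (j : 'I_n) : 'rV[int]_n :=
  if b then - delta_mx 0 j + \sum_(k < n | (j < k)%N) a j k *: delta_mx 0 k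
  else delta_mx 0 j.

(* The maximal cones are indexed by s : {ffun 'I_n -> bool}, the cone of s
   being generated by the rays bott_ray a (s j) j, the rows of bott_cone. *)
Definition bott_cone a s : 'M[int]_n := \matrix_j bott_ray a (s j) j.

(* The rows express the generators of the cone s in the basis of Z^n formed by
   the generators of the cone t; equivalently, the columns express the dual
   basis of t in the dual basis of s. *)
Definition bott_change a s t : 'M[int]_n :=
  bott_cone a s *m invmx (bott_cone a t).

Lemma bott_cone_unit a s : bott_cone a s \in unitmx.
Proof.
have trigE : is_trig_mx (bott_cone a s)^T.
  apply/is_trig_mxP => i j ij; rewrite !mxE /bott_ray.
  have ji : (j == i) = false by apply/negbTE; rewrite neq_ltn ij orbT.
  case: (s j); rewrite !mxE /= eq_sym ?ji ?oppr0 //.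
  rewrite add0r summxE big1 // => k jk; rewrite !mxE /=.
  have -> : (i == k) = false by apply/negbTE; rewrite neq_ltn (ltn_trans ij jk).
  by rewrite mulr0.
rewrite unitmxE -det_tr (det_trig trigE); apply: rpred_prod => i _.
rewrite !mxE /bott_ray; case: (s i); rewrite !mxE !eqxx //= summxE big1 ?addr0 //.
move=> k ik; rewrite !mxE /=.
by have -> : (i == k) = false; [apply/negbTE; rewrite neq_ltn ik | rewrite mulr0].
Qed.

Lemma bott_change_refl a s : bott_change a s s = 1%:M.
Proof. exact/mulmxV/bott_cone_unit. Qed.

Lemma bott_change_comp a s t r :
  bott_change a s t *m bott_change a t r = bott_change a s r.
Proof. by rewrite /bott_change mulmxA mulmxKV // bott_cone_unit. Qed.

Lemma bott_change_row a s t i k :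
  s i = t i -> bott_change a s t i k = (i == k)%:R.
Proof.
move=> st; have <- : (1%:M : 'M[int]_n) i k = (i == k)%:R by rewrite mxE.
rewrite -(bott_change_refl a t) !mxE; apply: eq_bigr => j _.
by rewrite !mxE st.
Qed.

End BottFan.

Section RealBott.
Context (R : realType) {n : nat} (a : 'M[int]_n).
Implicit Types (s t r : {ffun 'I_n -> bool}) (x y z : 'rV[R]_n).

(* Since the dual cone of the maximal cone s is freely generated, as a
   semigroup, by the dual basis of s, the real points of its affine toric
   variety form R^n, with the n corresponding characters as coordinates.  A
   Laurent monomial change of coordinates glues two such charts along the
   affine piece of the common face, where the coordinates attached to the
   generators that are not shared do not vanish.  (Here 0 ^ k = 0 for k < 0,
   but negative powers of 0 do not occur on that piece.) *)
Definition glue_dom s t : set 'rV[R]_n :=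
  [set x | forall j, s j != t j -> x 0 j != 0].

Definition glue_map s t x : 'rV[R]_n :=
  \row_k \prod_j (x 0 j ^ bott_change a s t j k).

Local Notation pieces := {s : {ffun 'I_n -> bool} & 'rV[R]_n}.

Definition piece s x : pieces := existT (fun=> 'rV[R]_n) s x.

Definition glued (p q : pieces) : bool :=
  `[< glue_dom (projT1 p) (projT1 q) (projT2 p) /\
      projT2 q = glue_map (projT1 p) (projT1 q) (projT2 p) >].

Lemma glue_map_refl s x : glue_map s s x = x.
Proof.
apply/rowP => k; rewrite mxE (bigD1 k) //= big1 ?mulr1.
  by rewrite bott_change_refl mxE eqxx expr1z.
by move=> j jk; rewrite bott_change_refl mxE (negbTE jk) expr0z.
Qed.

Lemma glue_map_eq0 s t x k : glue_dom s t x ->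
  (glue_map s t x 0 k == 0) = (s k == t k) && (x 0 k == 0).
Proof.
move=> dx; rewrite mxE prodf_seq_eq0; apply/hasP/andP => [[i _ /=]|[/eqP st x0]].
  move=> xi0; have x0 : x 0 i == 0.
    by apply: contraTT xi0 => xi; rewrite expfz_neq0.
  have st : s i = t i by apply/eqP; apply: contraTT x0; exact: dx.
  move: xi0; rewrite (bott_change_row _ _ st).
  case: (i =P k) => [<- //|_]; first by rewrite st eqxx.
  by rewrite expr0z oner_eq0.
exists k; first by rewrite mem_index_enum.
by rewrite /= (bott_change_row _ _ st) eqxx expr1z.
Qed.

Lemma glue_map_comp s t r x : glue_dom s t x ->
  glue_map t r (glue_map s t x) = glue_map s r x.
Proof.
move=> dx; apply/rowP => k; rewrite !mxE.
under eq_bigr => j _.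
  rewrite mxE (big_morph (fun u : R => u ^ bott_change a t r j k)
    (fun u v => expfzMl u v _) (exp1rz _ _)).
  over.
rewrite exchange_big /=; apply: eq_bigr => i _.
rewrite -(bott_change_comp a s t r) mxE.
have [xi0|xi0] := eqVneq (x 0 i) 0.
  have st : s i = t i by apply/eqP; apply: contraTT (introT eqP xi0); exact: dx.
  rewrite (bigD1 i) //= big1 => [|j ji]; last first.
    by rewrite (bott_change_row _ _ st) eq_sym (negbTE ji) expr0z exp1rz.
  rewrite (bott_change_row _ _ st) eqxx expr1z mulr1.
  rewrite (bigD1 i) //= big1 => [|j ji]; last first.
    by rewrite (bott_change_row _ _ st) eq_sym (negbTE ji) mul0r.
  by rewrite (bott_change_row _ _ st) eqxx mul1r addr0.
rewrite (big_morph (fun m : int => x 0 i ^ m)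
  (fun u v => expfzDr u v xi0) (expr0z _)).
by apply: eq_bigr => j _; rewrite exprz_exp.
Qed.

Lemma glued_refl : reflexive glued.
Proof.
case=> s x; apply/asboolP; split=> /=; last by rewrite glue_map_refl.
by move=> j; rewrite eqxx.
Qed.

Lemma glued_trans : transitive glued.
Proof.
move=> [t y] [s x] [r z] /asboolP[/= dx ->] /asboolP[/= dy ->].
apply/asboolP; split=> /=; last by rewrite glue_map_comp.
move=> j; apply: contraNN => x0.
have st : s j == t j by apply: contraTT x0; exact: dx.
rewrite (eqP st); have : glue_map s t x 0 j == 0 by rewrite glue_map_eq0 // st.
by apply: contraTT; exact: dy.
Qed.

Lemma glued_sym : symmetric glued.
Proof.
suff sym p q : glued p q -> glued q p by move=> p q; apply/idP/idP; exact: sym.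
case: p q => [s x] [t y] /asboolP[/= dx ->]; apply/asboolP; split=> /=.
  by move=> j; rewrite eq_sym glue_map_eq0 // => /negbTE ->.
by rewrite glue_map_comp // glue_map_refl.
Qed.

Canonical glued_equiv := EquivRel glued glued_refl glued_sym glued_trans.

Definition real_bott_space : topologicalType :=
  quotient_topology {eq_quot glued}%qT.

Definition real_bott_param s x : real_bott_space :=
  (\pi_(quotient_topology {eq_quot glued}) (piece s x))%qT.

Definition real_bott_chart s : chart R n real_bott_space :=
  Chart (range (real_bott_param s))
        (fun p => xget 0 [set x | real_bott_param s x = p]).

Definition real_bott_manifold : chartedSpace R n :=
  ChartedSpace (range real_bott_chart).

End RealBott.

(* Main.v *)
Require Import Defs.
From mathcomp Require Import all_boot all_order all_algebra.
From mathcomp Require Import all_classical all_reals all_analysis.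
From mathcomp Require Import ring lra.

(** The last coordinate makes [Y_n] an [RP^1]-bundle over [Y_(n-1)] whose
transition maps [x -> c x] and [x -> c / x] lie in [PGL_2(R)].  That group also
acts on the closed hyperbolic half-plane [{x + i rho | rho >= 0} u {oo}], a disc
with boundary [RP^1]; the two transition maps extend to [w -> c w] and
[w -> c / w], followed if necessary by the reflection of [C] that brings [w] back
to [rho >= 0].  Replacing the fibres [RP^1] by these discs gives a compact
[W] with boundary [Y_n]: its charts are those of [Y_n] with the extra coordinate
[rho], and each of them has image the whole half-space. *)

Set Implicit Arguments.
Unset Strict Implicit.
Unset Printing Implicit Defensive.
Import Order.TTheory GRing.Theory Num.Theory.
Import numFieldNormedType.Exports.
Local Open Scope classical_set_scope.
Local Open Scope ring_scope.

(** By triangularity the last coordinate enters no other coordinate of a change of charts, so it can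
    serve as a fibre coordinate. Real Moebius maps of P^1(C) commute with complex conjugation, hence
    act on the quotient, which is the closed disc; for this reason the cocycle identities of Y_n
    survive the filling of the fibres. The price is that rho is multiplied by |c|, which is not
    rational in the coordinates. Smoothness is recovered because c does not vanish on an overlap and
    so keeps its sign locally. As W is a quotient of a disjoint union, its Hausdorff property is a
    genuine statement: the graphs of the gluings must be closed. *)

(** * Rational functions and their smoothness *)

Section RationalFunctions.
Context {R : realType} {m : nat}.
Implicit Types (U : set 'rV[R]_m) (f g : 'rV[R]_m -> R).

(* Membership is closed under partial derivatives, hence implies smoothness; all
   coordinate changes below are of this form, so no chain rule is needed. *)
Inductive ratfun U : ('rV[R]_m -> R) -> Prop :=
| ratfun_cst c : ratfun U (fun=> c)
| ratfun_coord i : ratfun U (fun x => x 0 i)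
| ratfunD f g : ratfun U f -> ratfun U g -> ratfun U (fun x => f x + g x)
| ratfunM f g : ratfun U f -> ratfun U g -> ratfun U (fun x => f x * g x)
| ratfunV f : ratfun U f -> (forall x, U x -> f x != 0) ->
    ratfun U (fun x => (f x)^-1).

Lemma ratfun_prod U (I : Type) (r : seq I) (F : I -> 'rV[R]_m -> R) :
  (forall i, ratfun U (F i)) -> ratfun U (fun x => \prod_(i <- r) F i x).
Proof.
move=> hF; elim: r => [|i r ih].
  by under eq_fun do rewrite big_nil; exact: ratfun_cst.
by under eq_fun do rewrite big_cons; exact: ratfunM.
Qed.

Lemma ratfunX U f k : ratfun U f -> ratfun U (fun x => f x ^+ k).
Proof.
move=> hf; elim: k => [|k ih].
  by under eq_fun do rewrite expr0; exact: ratfun_cst.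
by under eq_fun do rewrite exprS; exact: ratfunM.
Qed.

Lemma ratfun_exprz U f (z : int) : ratfun U f ->
  (forall x, U x -> f x != 0) -> ratfun U (fun x => f x ^ z).
Proof.
move=> hf f0; case: z => k; first exact: ratfunX.
by apply: ratfunV; [exact: ratfunX | move=> x /f0 fx; rewrite expf_neq0].
Qed.

Lemma ratfun_continuous U f x : ratfun U f -> U x -> {for x, continuous f}.
Proof.
move=> + Ux; elim=> [c|i|{}f g _ hf _ hg|{}f g _ hf _ hg|{}f _ hf f0].
- exact: cst_continuous.
- exact: coord_continuous.
- exact: continuousD.
- exact: continuousM.
- by apply: continuousV => //; exact: f0.
Qed.

Lemma is_derive_coord (i j : 'I_m) (x : 'rV[R]_m) :
  is_derive x (delta_mx 0 i : 'rV[R]_m) (fun y : 'rV[R]_m => y 0 j : R)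
    (i == j)%:R.
Proof.
have h : (fun h : R => h^-1 *:
    (((fun y : 'rV[R]_m => y 0 j : R) \o shift x) (h *: delta_mx 0 i) - x 0 j))
    @ 0^' --> ((i == j)%:R : R).
  apply: (@cvg_trans _ ((cst (i == j)%:R : R -> R) @ 0^')); last exact: cvg_cst.
  apply: near_eq_cvg; near=> h => /=.
  have h0 : h != 0 by near: h; exact: nbhs_dnbhs_neq.
  by rewrite !mxE eqxx /= addrK scalerA mulVf // scale1r eq_sym.
by apply: DeriveDef; [apply/cvg_ex; exists (i == j)%:R | exact: cvg_lim h].
Unshelve. all: by end_near. Qed.

Lemma ratfun_derive U f (i : 'I_m) : ratfun U f ->
  exists2 f', ratfun U f' &
    forall x, U x -> is_derive x (delta_mx 0 i : 'rV[R]_m) f (f' x).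
Proof.
elim=> [c|j|{}f g hf [f' rf' df] hg [g' rg' dg]
  |{}f g hf [f' rf' df] hg [g' rg' dg]|{}f hf [f' rf' df] f0].
- exists (fun=> 0); first exact: ratfun_cst.
  by move=> x _; exact: is_derive_cst.
- exists (fun=> (i == j)%:R); first exact: ratfun_cst.
  by move=> x _; exact: is_derive_coord.
- exists (fun x => f' x + g' x); first exact: ratfunD.
  by move=> x Ux; have := df x Ux; have := dg x Ux => dgx dfx; exact: is_deriveD.
- exists (fun x => f x * g' x + g x * f' x).
    by apply: ratfunD; exact: ratfunM.
  by move=> x Ux; have := df x Ux; have := dg x Ux => dgx dfx; exact: is_deriveM.
- exists (fun x => - 1 * ((f x)^-1 ^+ 2) * f' x).
    by do 2?[apply: ratfunM => //]; [exact: ratfun_cst | apply/ratfunX/ratfunV].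
  move=> x Ux; have [dfx <-] := df x Ux; apply: DeriveDef.
    by apply: derivableV => //; exact: f0.
  by rewrite deriveV//; [rewrite mulN1r exprVn | exact: f0].
Qed.

(** The slack between [f] and [g] is what the induction needs: a partial derivative of [g] is known
    to agree with a rational function on [U] only. *)
Lemma ratfun_Ck U f g k : open U -> ratfun U f ->
  (forall x, U x -> f x = g x) -> Ck_on k U g.
Proof.
move=> oU; elim: k f g => [|k ih] f g rf fg.
all: have nfg x : U x -> \forall y \near x, f y = g y
  by move=> Ux; apply: (filterS fg); apply: open_nbhs_nbhs; split.
all: have cg x : U x -> {for x, continuous g}
  by move=> Ux; rewrite /prop_for /continuous_at -fg //;
     apply: cvg_trans (ratfun_continuous rf Ux); exact: (near_eq_cvg (nfg _ Ux)).
  by [].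
split=> // i; have [f' rf' df] := ratfun_derive i rf.
have dg x : U x -> is_derive x (delta_mx 0 i : 'rV[R]_m) g (f' x).
  by move=> Ux; apply: near_eq_is_derive (nfg _ Ux) (df _ Ux).
split; first by move=> x /dg [].
by apply: (ih f') => // x /dg [_ ->].
Qed.

Lemma ratfun_smooth U (l : nat) (g : 'rV[R]_m -> 'rV[R]_l) : open U ->
  (forall j, ratfun U (fun x => g x 0 j)) -> smooth_on U g.
Proof. by move=> oU rg j k; exact: (ratfun_Ck k oU (rg j)). Qed.

Lemma open_ratfun_preimage U f (D : set R) : open U -> ratfun U f -> open D ->
  open (U `&` f @^-1` D).
Proof.
rewrite !openE => oU rf oD x [Ux Dfx]; apply: filterI; first exact: oU.
exact: (ratfun_continuous rf Ux) (oD _ Dfx).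
Qed.

End RationalFunctions.

(** * Limits of identities, and boxes with rational endpoints *)

Section TopologicalFacts.
Context {R : realType}.

Lemma continuous_rV (T : topologicalType) (m : nat) (f : T -> 'rV[R]_m) x :
  (forall j, continuous_at x (fun y => f y 0 j)) -> {for x, continuous f}.
Proof.
move=> fc A [P fP PA]; have : \forall y \near x, forall i j, P i j (f y i j).
  by apply: filter_forall => i; apply: filter_forall => j; rewrite (ord1 i);
     have := fP 0 j; exact: fc.
by apply: filterS => y Py; apply: PA => i j; exact: Py.
Qed.

(** Serves to pass identities along the graph of a gluing to a limit point. Continuity is asked at
    [p] only, since the functions involved may have poles elsewhere. *)
Lemma closure_eq (T : topologicalType) (G : set T) (f g : T -> R) p :
  closure G p -> {for p, continuous f} -> {for p, continuous g} ->
  (forall q, G q -> f q = g q) -> f p = g p.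
Proof.
move=> Gp fc gc fg; apply/eqP; rewrite -subr_eq0; apply/negPn/negP => h.
have hc : {for p, continuous (fun q => f q - g q)} by exact: continuousB.
have n0 := open_nbhs_nbhs (conj (@open_neq R 0) h).
have [q [Gq /=]] := Gp _ (hc [set r | r != 0] n0).
by rewrite fg // subrr eqxx.
Qed.

Definition rat_box (m : nat) (ab : {ffun 'I_m -> rat * rat}) : set 'rV[R]_m :=
  [set x | forall i, ratr (ab i).1 < x 0 i < ratr (ab i).2].

Lemma open_rat_box m (ab : {ffun 'I_m -> rat * rat}) : open (rat_box ab).
Proof.
rewrite openE => x abx.
exists (fun _ j => [set r | ratr (ab j).1 < r < ratr (ab j).2]).
  move=> i j; rewrite (ord1 i).
  have /andP[ax xb] := abx j.
  apply: filterS2 (open_nbhs_nbhs (conj (@open_gt R _) ax))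
    (open_nbhs_nbhs (conj (@open_lt R _) xb)) => r /= ar rb.
  by rewrite /= ar rb.
by move=> y /= aby i; exact: aby.
Qed.

Lemma rat_box_nbhs m (x : 'rV[R]_m) A : nbhs x A ->
  exists2 ab : {ffun 'I_m -> rat * rat}, rat_box ab x & rat_box ab `<=` A.
Proof.
move=> [P xP PA].
have /choice[ab abP] (j : 'I_m) : exists ab : rat * rat,
    ratr ab.1 < x 0 j < ratr ab.2 /\
    [set r | ratr ab.1 < r < ratr ab.2] `<=` P 0 j.
  have /nbhs_ballP[e e0 eP] := xP 0 j.
  have e0' : 0 < e by [].
  have [a] := rat_in_itvoo (ltac:(lra) : x 0 j - e < x 0 j).
  have [b] := rat_in_itvoo (ltac:(lra) : x 0 j < x 0 j + e).
  rewrite !in_itv /= => /andP[xb be] /andP[ea ax].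
  exists (a, b); split=> /=; first by rewrite ax.
  move=> r /= /andP[ar rb]; apply: eP; rewrite /ball /= ltr_norml; lra.
exists [ffun j => ab j]; first by move=> j; rewrite ffunE; case: (abP j).
move=> y yab; apply: PA => i j; rewrite (ord1 i).
by case: (abP j) => _; apply; have := yab j; rewrite ffunE.
Qed.

End TopologicalFacts.

(** * Triangularity of the exponent matrices *)

Section BottTriangular.
Context {n : nat} (a : 'M[int]_n).
Implicit Types (s t : {ffun 'I_n -> bool}) (j k : 'I_n).

Lemma bott_ray_lt b j k : (k < j)%N -> bott_ray a b j 0 k = 0.
Proof.
move=> kj; rewrite /bott_ray; have kNj : k != j by rewrite neq_ltn kj.
case: b; rewrite !mxE /= (negbTE kNj) // oppr0 add0r summxE big1 // => i ji.
have kNi : k != i by rewrite neq_ltn (ltn_trans kj ji).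
by rewrite !mxE /= (negbTE kNi) mulr0.
Qed.

Lemma bott_ray_diag b j : bott_ray a b j 0 j = (-1) ^+ b.
Proof.
rewrite /bott_ray; case: b; rewrite !mxE !eqxx //=.
rewrite summxE big1 ?addr0 // => i ji.
have jNi : j != i by rewrite neq_ltn ji.
by rewrite !mxE /= (negbTE jNi) mulr0.
Qed.

Lemma bott_change_mul s t j k :
  \sum_i bott_change a s t j i * bott_ray a (t i) i 0 k =
  bott_ray a (s j) j 0 k.
Proof.
transitivity ((bott_change a s t *m bott_cone a t) j k).
  by rewrite mxE; apply: eq_bigr => i _; congr (_ * _); rewrite [RHS]mxE.
by rewrite mulmxKV ?bott_cone_unit // mxE.
Qed.

(** Forward substitution in [bott_change_mul]: the terms with i < k vanish by induction, those with
    i > k because the rays of [t] are triangular, and what remains is the entry times a diagonal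
    sign. *)
Lemma bott_change_lt s t j k : (k < j)%N -> bott_change a s t j k = 0.
Proof.
move: {2}(val k) (leqnn k) => N; elim/ltn_ind: N k => N ih k kN kj.
have := bott_change_mul s t j k; rewrite (bott_ray_lt _ kj) (bigD1 k) //= big1.
  by rewrite addr0 bott_ray_diag; case: (t k); rewrite ?mulrN1 ?mulr1 // => /eqP;
     rewrite oppr_eq0 => /eqP.
move=> i ik; have [ik'|ki|/val_inj ii] := ltngtP i k; last first.
- by rewrite ii eqxx in ik.
- by rewrite bott_ray_lt // mulr0.
- by rewrite (ih i (leq_trans ik' kN)) ?mul0r ?leqnn // (ltn_trans ik').
Qed.

Lemma bott_change_diag s t j :
  bott_change a s t j j = if s j == t j then 1 else -1.
Proof.
have := bott_change_mul s t j j; rewrite (bigD1 j) //= big1.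
  rewrite addr0 !bott_ray_diag => h.
  have -> : bott_change a s t j j = (-1) ^+ s j * (-1) ^+ t j.
    by rewrite -h -mulrA -expr2 sqrr_sign mulr1.
  by rewrite -signr_addb; case: (s j); case: (t j).
move=> i ij; have [ik'|ki|/val_inj ii] := ltngtP i j; last by rewrite ii eqxx in ij.
  by rewrite bott_change_lt ?mul0r.
by rewrite bott_ray_lt // mulr0.
Qed.

End BottTriangular.

(** * Dependence of the toric gluing on single coordinates *)

Section GlueMap.
Context {R : realType} {n : nat} (a : 'M[int]_n).
Implicit Types (s t r : {ffun 'I_n -> bool}) (x y : 'rV[R]_n) (j k : 'I_n).

Lemma glue_mapE s t x k :
  glue_map a s t x 0 k = \prod_j x 0 j ^ bott_change a s t j k.
Proof. by rewrite mxE. Qed.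

(** Exponents vanish below the diagonal, and a generator common to both cones contributes to its own
    coordinate only. *)
Lemma eq_glue_map s t x y k :
  (forall j, (j <= k)%N -> (j == k) || (s j != t j) -> x 0 j = y 0 j) ->
  glue_map a s t x 0 k = glue_map a s t y 0 k.
Proof.
move=> xy; rewrite !glue_mapE; apply: eq_bigr => j _.
have [kj|jk] := ltnP k j; first by rewrite bott_change_lt.
have [jEk|jNk] := eqVneq j k; first by rewrite xy ?jEk ?leqnn ?eqxx.
have [st|st] := eqVneq (s j) (t j).
  by rewrite bott_change_row // (negbTE jNk) !expr0z.
by rewrite xy // st orbT.
Qed.

Lemma glue_map_first s t x k : (forall i : 'I_n, (i < k)%N -> s i = t i) ->
  glue_map a s t x 0 k = x 0 k ^ (if s k == t k then 1 else -1 : int).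
Proof.
move=> st; rewrite glue_mapE (bigD1 k) //= bott_change_diag big1 ?mulr1 // => i ik.
have [ik'|ki|/val_inj ii] := ltngtP i k; last by rewrite ii eqxx in ik.
  by rewrite bott_change_row ?st // (negbTE ik) expr0z.
by rewrite bott_change_lt.
Qed.

Definition set_coord (c : R) (k : 'I_n) x : 'rV[R]_n :=
  \row_j if j == k then c else x 0 j.

Lemma set_coordE c k x j : set_coord c k x 0 j = if j == k then c else x 0 j.
Proof. by rewrite mxE. Qed.

(** Splits off the [k]-th variable; at the last index the remaining factor is the slope of the fibre
    map. *)
Lemma glue_map_set_coord s t x c k :
  glue_map a s t (set_coord c k x) 0 k =
  c ^ (if s k == t k then 1 else -1 : int) *
  glue_map a s t (set_coord 1 k x) 0 k.
Proof.
rewrite !glue_mapE (bigD1 k) //= [in RHS](bigD1 k) //= !set_coordE eqxx exp1rz mul1r.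
rewrite bott_change_diag; congr (_ * _).
by apply: eq_bigr => j jk; rewrite !set_coordE (negbTE jk).
Qed.

Lemma set_coord_id x k : set_coord (x 0 k) k x = x.
Proof. by apply/rowP => j; rewrite mxE; case: eqVneq => // ->. Qed.

Lemma ratfun_glue_map s t (m : nat) (U : set 'rV[R]_m)
    (f : 'rV[R]_m -> 'rV[R]_n) k :
  (forall j, ratfun U (fun u => f u 0 j)) ->
  (forall u, U u -> glue_dom s t (f u)) ->
  ratfun U (fun u => glue_map a s t (f u) 0 k).
Proof.
move=> rf fU; under eq_fun do rewrite glue_mapE; apply: ratfun_prod => j.
have [st|st] := eqVneq (s j) (t j).
  under eq_fun do rewrite bott_change_row //.
  (* The exponent of a shared generator is 1 or 0, so no coordinate that may vanish is inverted. *)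
  by case: (j == k); [exact: (ratfunX 1)|exact: (ratfunX 0)].
by apply: ratfun_exprz => // u /fU; apply.
Qed.

Lemma open_glue_dom s t : open (glue_dom s t : set 'rV[R]_n).
Proof.
have nb (x : 'rV[R]_n) : glue_dom s t x ->
    forall j, nbhs x [set y : 'rV[R]_n | s j != t j -> y 0 j != 0].
  move=> dx j; have [st|st] := eqVneq (s j) (t j).
    by apply: (@filterE _ (nbhs x)) => y /=.
  have := open_nbhs_nbhs (conj (@open_neq R 0) (dx j st)).
  move=> /(@coord_continuous R 1 n 0 j x).
  by apply: (@filterS _ (nbhs x)) => y y0 _.
by rewrite openE => x dx; exact: (filter_forall _ (nb x dx)).
Qed.

End GlueMap.

(** * The extra coordinate rho and reflection into the half-space *)

Section HalfSpaceCoordinates.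
Context {R : realType} {n : nat}.
Implicit Types (x : 'rV[R]_n) (w : 'rV[R]_n.+1).

Definition hcons (c : R) x : 'rV[R]_n.+1 :=
  \row_i if unlift ord0 i is Some j then x 0 j else c.

Definition htail w : 'rV[R]_n := \row_j w 0 (lift ord0 j).

Lemma hcons0 c x : hcons c x 0 0 = c.
Proof. by rewrite mxE unlift_none. Qed.

Lemma hconsS c x j : hcons c x 0 (lift ord0 j) = x 0 j.
Proof. by rewrite mxE liftK. Qed.

Lemma htailE w j : htail w 0 j = w 0 (lift ord0 j).
Proof. by rewrite mxE. Qed.

Lemma hcons_htail w : hcons (w 0 0) (htail w) = w.
Proof.
apply/rowP => i; rewrite mxE; case: unliftP => [j ->|->] //.
by rewrite htailE.
Qed.

Lemma htail_hcons c x : htail (hcons c x) = x.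
Proof. by apply/rowP => j; rewrite htailE hconsS. Qed.

(** On a fibre coordinate x + i rho this picks, from a pair of complex conjugates, the one with rho
    >= 0. *)
Definition habs w : 'rV[R]_n.+1 := hcons `|w 0 0| (htail w).

Lemma habs0 w : habs w 0 0 = `|w 0 0|.
Proof. exact: hcons0. Qed.

Lemma htail_habs w : htail (habs w) = htail w.
Proof. exact: htail_hcons. Qed.

Lemma habs_id w : half_space w -> habs w = w.
Proof. by move=> w0; rewrite /habs ger0_norm // hcons_htail. Qed.

Lemma half_space_habs w : half_space (habs w).
Proof. by rewrite /half_space /= habs0. Qed.

End HalfSpaceCoordinates.

(** * Gluing the disc bundle *)

Section DiscGluing.
Context {R : realType} {m : nat} (a : 'M[int]_m.+1).
Implicit Types (s t r : {ffun 'I_m.+1 -> bool}) (w z : 'rV[R]_m.+2).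
Let l : 'I_m.+1 := ord_max.

(* In the chart [s], [w = (rho, x)] has base point [(x_j)_(j <> l)], stored
   in [hbase w] with [1] in place of [x_l], and fibre coordinate [x_l + i rho], of
   squared modulus [hnorm w]; [hslope] is the factor [c] by which the change of
   charts acts on the fibre. *)
Definition hbase w : 'rV[R]_m.+1 := set_coord 1 l (htail w).

Definition hnorm w : R := w 0 0 ^+ 2 + htail w 0 l ^+ 2.

Definition hslope s t w : R := glue_map a s t (hbase w) 0 l.

(** Since c / w = c conj(w) / |w|^2, scaling and inversion both amount, up to conjugation, to
    multiplying by c and dividing by this number. *)
Definition hden s t w : R := if s l == t l then 1 else hnorm w.

(** Where the last index is flipped, only the origin of the fibre is removed: a point with x_l = 0
    and rho > 0 can still be inverted. *)
Definition disc_dom s t : set 'rV[R]_m.+2 :=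
  [set w | glue_dom s t (hbase w) /\ hden s t w != 0].

Definition disc_glue s t w : 'rV[R]_m.+2 :=
  hcons (`|hslope s t w| * `|w 0 0| / hden s t w)
    (set_coord (hslope s t w * htail w 0 l / hden s t w) l
      (glue_map a s t (hbase w))).

Lemma hbase_habs w : hbase (habs w) = hbase w.
Proof. by rewrite /hbase htail_habs. Qed.

Lemma hnorm_habs w : hnorm (habs w) = hnorm w.
Proof. by rewrite /hnorm htail_habs habs0 real_normK ?num_real. Qed.

Lemma hden_habs s t w : hden s t (habs w) = hden s t w.
Proof. by rewrite /hden hnorm_habs. Qed.

Lemma hden_ge0 s t w : 0 <= hden s t w.
Proof. by rewrite /hden; case: ifP => // _; rewrite addr_ge0 ?sqr_ge0. Qed.

Lemma disc_dom_habs s t w : disc_dom s t (habs w) <-> disc_dom s t w.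
Proof. by rewrite /disc_dom /= hbase_habs hden_habs. Qed.

Lemma disc_glue_habs s t w : disc_glue s t (habs w) = disc_glue s t w.
Proof.
by rewrite /disc_glue /hslope hbase_habs hden_habs htail_habs habs0 normr_id.
Qed.

Lemma habs_disc_glue s t w : habs (disc_glue s t w) = disc_glue s t w.
Proof.
rewrite habs_id // /disc_glue /half_space /= hcons0.
by rewrite !mulr_ge0 // invr_ge0 hden_ge0.
Qed.

Lemma htail_disc_glue_neq s t w j : j != l ->
  htail (disc_glue s t w) 0 j = glue_map a s t (hbase w) 0 j.
Proof. by move=> jl; rewrite /disc_glue htail_hcons set_coordE (negbTE jl). Qed.

Lemma htail_disc_glue_max s t w :
  htail (disc_glue s t w) 0 l = hslope s t w * htail w 0 l / hden s t w.
Proof. by rewrite /disc_glue htail_hcons set_coordE eqxx. Qed.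

Lemma disc_glue0 s t w :
  disc_glue s t w 0 0 = `|hslope s t w| * `|w 0 0| / hden s t w.
Proof. by rewrite /disc_glue hcons0. Qed.

Lemma hbase_disc_glue s t w :
  hbase (disc_glue s t w) = set_coord 1 l (glue_map a s t (hbase w)).
Proof.
apply/rowP => j; rewrite /hbase !set_coordE; case: ifP => // /negbT.
exact: htail_disc_glue_neq.
Qed.

Lemma hnorm_disc_glue s t w :
  hnorm (disc_glue s t w) = hslope s t w ^+ 2 * hnorm w / hden s t w ^+ 2.
Proof.
rewrite /hnorm disc_glue0 htail_disc_glue_max !exprMn !exprVn.
by rewrite !real_normK ?num_real // mulrDr mulrDl.
Qed.

Lemma hslope_neq0 s t w : disc_dom s t w -> hslope s t w != 0.
Proof.
move=> [dw _]; rewrite /hslope glue_map_eq0 // negb_and /hbase set_coordE eqxx.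
by rewrite oner_neq0 orbT.
Qed.

Lemma disc_dom_refl s w : disc_dom s s w.
Proof. by split=> [j|]; rewrite ?eqxx // /hden eqxx oner_neq0. Qed.

Lemma disc_glue_refl s w : disc_glue s s w = habs w.
Proof.
rewrite /disc_glue /hslope /hden eqxx !glue_map_refl /hbase !set_coordE eqxx.
rewrite normr1 !mul1r !divr1; congr hcons; apply/rowP => j.
by rewrite !set_coordE; case: eqVneq => // ->.
Qed.

Lemma glued_hbase s t r w : disc_dom s t w -> disc_dom t r (disc_glue s t w) ->
  glue_dom t r (glue_map a s t (hbase w)).
Proof.
move=> dw [dg _] j tr; have := dg j tr; rewrite hbase_disc_glue set_coordE.
by case: (j =P l) => [-> _|//]; exact: hslope_neq0 dw.
Qed.

(** A twisted cocycle rule: following w -> c w by w -> c' / w gives w -> (c' / c) / w, whence the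
    exponent -1 when the second change flips the last index. It is the cocycle rule of [glue_map]
    with the last coordinate split off. *)
Lemma hslope_comp s t r w : disc_dom s t w ->
  hslope s r w = hslope s t w ^ (if t l == r l then 1 else -1 : int) *
                 hslope t r (disc_glue s t w).
Proof.
move=> dw; rewrite {1}/hslope -(glue_map_comp _ _ dw.1).
rewrite -[glue_map a s t _ in LHS](set_coord_id _ l) glue_map_set_coord.
by rewrite [in RHS]/hslope hbase_disc_glue.
Qed.

Lemma disc_dom_comp s t r w :
  disc_dom s t w -> disc_dom t r (disc_glue s t w) ->
  disc_dom s r w.
Proof.
move=> dw dg; split.
  have dt := glued_hbase dw dg.
  (* The base condition follows from transitivity of the gluing that defines Y, applied to
     [hbase w]. *)
  have h1 : glued a (piece s (hbase w)) (piece t (glue_map a s t (hbase w))).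
    by apply/asboolP; split=> //; exact: dw.1.
  have h2 : glued a (piece t (glue_map a s t (hbase w)))
      (piece r (glue_map a t r (glue_map a s t (hbase w)))).
    by apply/asboolP.
  by have /asboolP[] := glued_trans h1 h2.
have [_ ds] := dw; have [_ dt] := dg; move: ds dt; rewrite /hden.
rewrite hnorm_disc_glue /hden; have [->|st] := eqVneq (s l) (t l).
  by case: ifP => // _ _; rewrite expr1n divr1 mulf_eq0 negb_or => /andP[].
by move=> N0 _; case: ifP; rewrite ?oner_eq0.
Qed.

Lemma disc_glue_comp s t r w :
  disc_dom s t w -> disc_dom t r (disc_glue s t w) ->
  disc_glue t r (disc_glue s t w) = disc_glue s r w.
Proof.
move=> dw dg; have c0 := hslope_neq0 dw.
(* Used with u = |c| for rho and with u = c for x_l; the denominators involve c through its square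
   only. *)
have scale (u : R) : u ^+ 2 = hslope s t w ^+ 2 ->
    u ^ (if t l == r l then 1 else -1 : int) / hden s r w =
    u / (hden s t w * hden t r (disc_glue s t w)).
  move=> uc; have u0 : u != 0 by rewrite -sqrf_eq0 uc sqrf_eq0.
  have [_ dst] := dw; have [_ dsr] := disc_dom_comp dw dg; move: dst dsr.
  rewrite /(hden t) hnorm_disc_glue -uc /hden.
  by case: (s l); case: (t l); case: (r l);
    rewrite /= ?oner_eq0 ?expr1z ?exprN1 ?expr1n => N0 N1; field;
    rewrite ?u0 ?N0 ?N1.
have normz (e : bool) (v : R) : `|v ^ (if e then 1 else -1 : int)| =
    `|v| ^ (if e then 1 else -1 : int).
  by case: e; rewrite ?expr1z ?exprN1 ?normfV.
rewrite [LHS]/disc_glue [RHS]/disc_glue; congr hcons.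
  rewrite disc_glue0 (hslope_comp r dw) [in RHS]normrM normz.
  rewrite (ger0_norm (_ : 0 <= `|hslope s t w| * `|w 0 0| / hden s t w)).
    rewrite mulrAC [X in _ = X]mulrAC.
    have := scale `|hslope s t w| (real_normK (num_real _)).
    rewrite invfM => sc.
    transitivity (`|hslope t r (disc_glue s t w)| * `|w 0 0| *
      (`|hslope s t w| * ((hden s t w)^-1 * (hden t r (disc_glue s t w))^-1))).
      by ring.
    by rewrite -sc; ring.
  by rewrite !mulr_ge0 // invr_ge0 hden_ge0.
apply/rowP => j; rewrite !set_coordE; case: (eqVneq j l) => [_|jl].
  rewrite htail_disc_glue_max (hslope_comp r dw).
  have := scale (hslope s t w) erefl; rewrite invfM => sc.
  transitivity (hslope t r (disc_glue s t w) * htail w 0 l *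
    (hslope s t w * ((hden s t w)^-1 * (hden t r (disc_glue s t w))^-1))).
    by ring.
  by rewrite -sc; ring.
(* The remaining coordinates precede the last one, so resetting the latter to 1 at the intermediate
   point does not affect them. *)
rewrite -(glue_map_comp _ _ dw.1) hbase_disc_glue; apply: eq_glue_map => i ij _.
by rewrite set_coordE ifN //; apply: contra_neq jl => il; apply/val_inj/eqP;
   rewrite /= eqn_leq -ltnS ltn_ord -[X in (X <= _)%N](congr1 val il).
Qed.

Lemma disc_dom_sym s t w : disc_dom s t w -> disc_dom t s (disc_glue s t w).
Proof.
move=> dw; have c0 := hslope_neq0 dw; have [ds N0] := dw; split.
  move=> j ts; rewrite hbase_disc_glue set_coordE.
  case: (j =P l) => _; first by rewrite oner_eq0.
  by rewrite glue_map_eq0 // eq_sym (negbTE ts).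
have D0 := N0; move: N0; rewrite {1}/hden [hden t s _]/hden hnorm_disc_glue.
by case: (s l); case: (t l) => /= N0;
  rewrite ?oner_eq0 // mulf_neq0 ?invr_neq0 ?mulf_neq0 ?expf_neq0.
Qed.

Local Notation pieces := {s : {ffun 'I_m.+1 -> bool} & 'rV[R]_m.+2}.

(* The pieces are whole vector spaces rather than half-spaces: [w] and [habs w]
   represent the same point. *)
Definition disc_piece s w : pieces := existT (fun=> 'rV[R]_m.+2) s w.

Definition disc_glued (p q : pieces) : bool :=
  `[< disc_dom (projT1 p) (projT1 q) (projT2 p) /\
      habs (projT2 q) = disc_glue (projT1 p) (projT1 q) (projT2 p) >].

Lemma disc_glued_refl : reflexive disc_glued.
Proof.
case=> s w; apply/asboolP; split=> /=; first exact: disc_dom_refl.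
by rewrite disc_glue_refl.
Qed.

Lemma disc_glued_sym : symmetric disc_glued.
Proof.
suff sym p q : disc_glued p q -> disc_glued q p.
  by move=> p q; apply/idP/idP; exact: sym.
case: p q => [s w] [t z] /asboolP[/= dw zE]; apply/asboolP; split=> /=.
  by apply/disc_dom_habs; rewrite zE; exact: disc_dom_sym.
rewrite -disc_glue_habs zE disc_glue_comp ?disc_glue_refl //; exact: disc_dom_sym.
Qed.

Lemma disc_glued_trans : transitive disc_glued.
Proof.
move=> [t z] [s w] [r u] /asboolP[/= dw zE] /asboolP[/= /disc_dom_habs + uE].
rewrite zE => dz; apply/asboolP; split=> /=; first exact: disc_dom_comp dz.
by rewrite uE -disc_glue_habs zE disc_glue_comp.
Qed.

Canonical disc_glued_equiv :=
  EquivRel disc_glued disc_glued_refl disc_glued_sym disc_glued_trans.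

Definition disc_space : topologicalType :=
  quotient_topology {eq_quot disc_glued}%qT.

Definition disc_param s w : disc_space :=
  (\pi_(quotient_topology {eq_quot disc_glued}) (disc_piece s w))%qT.

End DiscGluing.

(** * The quotient space and the openness of its parametrisations *)

Section DiscSpace.
Context {R : realType} {m : nat} (a : 'M[int]_m.+1).
Implicit Types (s t r : {ffun 'I_m.+1 -> bool}) (w z : 'rV[R]_m.+2).
Let l : 'I_m.+1 := ord_max.
Local Notation W := (disc_space (R := R) a).

Lemma disc_paramP s t w z : disc_param a s w = disc_param a t z :> W <->
  disc_dom s t w /\ habs z = disc_glue a s t w.
Proof.
have eqP := @eqmodP _ (@disc_glued_equiv R m a) (disc_piece s w) (disc_piece t z).
split=> [h|h]; first by have /eqP/asboolP := h.
exact/eqP/asboolP.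
Qed.

Lemma disc_param_habs s w : disc_param a s (habs w) = disc_param a s w :> W.
Proof.
apply/esym/disc_paramP; split; first exact: disc_dom_refl.
by rewrite disc_glue_refl (habs_id (half_space_habs w)).
Qed.

Lemma disc_param_surj (p : W) : exists s w, p = disc_param a s w.
Proof.
case E : (repr p) => [s w]; exists s, w; rewrite /disc_param /disc_piece -E.
by rewrite reprK.
Qed.

Lemma disc_param_continuous s : continuous (disc_param a s : 'rV[R]_m.+2 -> W).
Proof.
move=> w; apply: (@continuous_comp _ _ _ (disc_piece s)).
  exact: existT_continuous.
exact: pi_continuous.
Qed.

Lemma ratfun_hbase U j : ratfun U (fun w => hbase w 0 j).
Proof.
suff -> : (fun w => hbase w 0 j) =
    if j == l then fun=> 1 else fun w => w 0 (lift ord0 j).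
  by case: ifP => _; [exact: ratfun_cst|exact: ratfun_coord].
by apply/funext => w; rewrite /hbase set_coordE htailE; case: ifP.
Qed.

Lemma ratfun_hnorm U : ratfun U (hnorm (R := R) (m := m)).
Proof.
apply: ratfunD; apply: ratfunX; first exact: ratfun_coord.
by under eq_fun do rewrite htailE; exact: ratfun_coord.
Qed.

Lemma ratfun_hden U s t : ratfun U (fun w => hden s t w).
Proof.
rewrite /hden; case: (s ord_max == t ord_max); first exact: ratfun_cst.
exact: ratfun_hnorm.
Qed.

Lemma ratfun_hslope U s t : U `<=` disc_dom s t ->
  ratfun U (fun w => hslope a s t w).
Proof.
move=> Ud; apply: ratfun_glue_map => [j|w /Ud[]//]; exact: ratfun_hbase.
Qed.

Lemma ratfun_htail_disc_glue U s t j : U `<=` disc_dom s t ->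
  ratfun U (fun w => htail (disc_glue a s t w) 0 j).
Proof.
move=> Ud; have [->|jl] := eqVneq j l.
  under eq_fun do rewrite htail_disc_glue_max htailE.
  apply: ratfunM; last by apply: ratfunV => [|w /Ud[]//]; exact: ratfun_hden.
  by apply: ratfunM; [exact: ratfun_hslope|exact: ratfun_coord].
under eq_fun do rewrite htail_disc_glue_neq //.
apply: ratfun_glue_map => [i|w /Ud[]//]; exact: ratfun_hbase.
Qed.

(** The coordinate rho of the gluing without its absolute values; [c] leaves room for the local sign
    of the slope. *)
Lemma ratfun_disc_glue0 U s t (c : R) : U `<=` disc_dom s t ->
  ratfun U (fun w => c * hslope a s t w * w 0 0 / hden s t w).
Proof.
move=> Ud; apply: ratfunM; last by apply: ratfunV => [|w /Ud[]//]; exact: ratfun_hden.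
apply: ratfunM; last exact: ratfun_coord.
by apply: ratfunM; [exact: ratfun_cst|exact: ratfun_hslope].
Qed.

Lemma open_disc_dom s t : open (disc_dom s t : set 'rV[R]_m.+2).
Proof.
have -> : disc_dom s t = (hbase @^-1` glue_dom s t) `&`
    ((fun w => hden s t w) @^-1` [set r : R | r != 0]) by [].
apply: open_ratfun_preimage; [|exact: ratfun_hden|exact: open_neq].
apply: open_comp; last exact: open_glue_dom.
move=> w _; apply: continuous_rV => j.
exact: (ratfun_continuous (ratfun_hbase setT j)).
Qed.

Lemma disc_glue_continuous s t w : disc_dom s t w ->
  {for w, continuous (disc_glue a s t : 'rV[R]_m.+2 -> 'rV[R]_m.+2)}.
Proof.
move=> dw; apply: continuous_rV => i.
have [j ->|->] := unliftP ord0 i.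
  under eq_fun do rewrite -htailE.
  by apply: ratfun_continuous dw; exact: ratfun_htail_disc_glue.
have -> : (fun w => disc_glue a s t w 0 0) =
    (fun w => `|1 * hslope a s t w * w 0 0 / hden s t w|).
  apply/funext => z; rewrite disc_glue0 mul1r !normrM normfV.
  by rewrite (ger0_norm (hden_ge0 _ _ _)).
have rf := ratfun_disc_glue0 1 (@subset_refl _ (disc_dom s t)).
exact: cvg_norm (ratfun_continuous rf dw).
Qed.

Definition hflip w : 'rV[R]_m.+2 := hcons (- w 0 0) (htail w).

Lemma habs_continuous : continuous (habs : 'rV[R]_m.+2 -> 'rV[R]_m.+2).
Proof.
move=> w; apply: continuous_rV => i; have [j ->|->] := unliftP ord0 i.
  by under eq_fun do rewrite -htailE htail_habs htailE; exact: coord_continuous.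
under eq_fun do rewrite habs0.
exact: cvg_norm (@coord_continuous R 1 m.+2 0 0 w).
Qed.

Lemma hflip_continuous : continuous hflip.
Proof.
move=> w; apply: continuous_rV => i; have [j ->|->] := unliftP ord0 i.
  by under eq_fun do rewrite hconsS htailE; exact: coord_continuous.
by under eq_fun do rewrite hcons0; apply: continuousN; exact: coord_continuous.
Qed.

Lemma habs_hflip w : habs (hflip w) = habs w.
Proof. by rewrite /habs /hflip hcons0 htail_hcons normrN. Qed.

Lemma habs_eq w z : habs w = habs z -> z = w \/ z = hflip w.
Proof.
move=> wz; have tz : htail z = htail w by rewrite -htail_habs -wz htail_habs.
have /eqP : `|z 0 0| = `|w 0 0| by rewrite -!habs0 wz.
rewrite eqr_norm2 => /orP[]/eqP z0; [left|right].
  by rewrite -(hcons_htail z) z0 tz hcons_htail.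
by rewrite -(hcons_htail z) z0 tz.
Qed.

(** In the piece [t], the points glued to [V] are those of the open set [disc_dom t s] which the
    continuous gluing sends into [V] or its mirror image. *)
Lemma disc_param_open s (V : set 'rV[R]_m.+2) : open V ->
  open (disc_param a s @` V : set W).
Proof.
move=> oV; suff : open ((\pi_W)%qT @^-1` (disc_param a s @` V)) by [].
apply/sigT_openP => t; rewrite openE => z [w Vw] /disc_paramP[dw zE].
have dz : disc_dom t s z by apply/disc_dom_habs; rewrite zE; exact: disc_dom_sym.
have gE : disc_glue a t s z = habs w.
  by rewrite -disc_glue_habs zE disc_glue_comp ?disc_glue_refl //; exact: disc_dom_sym.
have nbV : \forall u \near z,
    V (disc_glue a t s u) \/ V (hflip (disc_glue a t s u)).
  have gc := disc_glue_continuous dz.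
  have [wE|wE] := habs_eq (habs_id (half_space_habs w)).
    have : nbhs (disc_glue a t s z) V by rewrite gE -wE; exact: open_nbhs_nbhs.
    by move=> /gc; apply: (@filterS _ (nbhs z)) => u; left.
  have fc : {for z, continuous (hflip \o disc_glue a t s)}.
    by apply: continuous_comp => //; exact: hflip_continuous.
  have : nbhs ((hflip \o disc_glue a t s) z) V.
    by rewrite /= gE -wE; exact: open_nbhs_nbhs.
  by move=> /fc; apply: (@filterS _ (nbhs z)) => u; right.
have nbd : nbhs z (disc_dom t s).
  exact: open_nbhs_nbhs (conj (@open_disc_dom t s) dz).
apply: (@filterS _ (nbhs z)) (filterI nbV nbd) => u [Vu du].
have pE v : habs v = disc_glue a t s u -> disc_param a s v = disc_param a t u :> W.
  by move=> vE; apply/esym/disc_paramP.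
case: Vu => Vu; [exists (disc_glue a t s u)|exists (hflip (disc_glue a t s u))] => //;
  by apply: pE; rewrite ?habs_hflip habs_disc_glue.
Qed.

End DiscSpace.

(** * Charts of the disc bundle *)

Section DiscManifold.
Context {R : realType} {m : nat} (a : 'M[int]_m.+1).
Implicit Types (s t r : {ffun 'I_m.+1 -> bool}) (w z : 'rV[R]_m.+2).
Let l : 'I_m.+1 := ord_max.
Local Notation W := (disc_space (R := R) a).

Definition disc_chart s : chart R m.+2 W :=
  Chart (range (disc_param a s))
    (fun p => xget 0 [set w | half_space w /\ disc_param a s w = p]).

Definition disc_manifold : chartedSpace R m.+2 := ChartedSpace (range disc_chart).

Lemma disc_chart_param s w : disc_chart s (disc_param a s w) = habs w.
Proof.
apply: xget_subset1.
  by split; [exact: half_space_habs|exact: disc_param_habs].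
move=> x y [x0 xE] [y0 yE].
have /disc_paramP[_] : disc_param a s x = disc_param a s y :> W by rewrite xE yE.
by rewrite disc_glue_refl !habs_id.
Qed.

Lemma disc_chartP s (p : W) : chart_dom (disc_chart s) p ->
  half_space (disc_chart s p) /\ disc_param a s (disc_chart s p) = p.
Proof.
move=> [w _ <-]; rewrite disc_chart_param disc_param_habs.
by split=> //; exact: half_space_habs.
Qed.

Lemma open_disc_chart_dom s : open (chart_dom (disc_chart s)).
Proof. exact: disc_param_open openT. Qed.

Lemma disc_chart_continuous s (p : W) : chart_dom (disc_chart s) p ->
  {for p, continuous (disc_chart s)}.
Proof.
move=> [w _ <-] A; rewrite disc_chart_param => /habs_continuous.
rewrite /= nbhsE => -[V [oV Vw] VA].
have : open_nbhs (disc_param a s w : W) (disc_param a s @` V).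
  by split; [exact: disc_param_open|exists w].
move=> /open_nbhs_nbhs; apply: (@filterS _ (nbhs (disc_param a s w : W))).
move=> _ [v Vv <-]; suff : A (disc_chart s (disc_param a s v)) by [].
by rewrite disc_chart_param; exact: VA.
Qed.

Lemma disc_chart_open_map s (V : set W) :
  open V -> V `<=` chart_dom (disc_chart s) ->
  exists2 O : set 'rV[R]_m.+2, open O & disc_chart s @` V = O `&` half_space.
Proof.
move=> oV Vd; exists (disc_param a s @^-1` V).
  by apply: open_comp oV => w _; exact: disc_param_continuous.
apply/seteqP; split=> [_ [p Vp <-]|w [Vw w0]].
  by have [h0 hp] := disc_chartP (Vd _ Vp); split=> //; rewrite /preimage /= hp.
by exists (disc_param a s w) => //; rewrite disc_chart_param habs_id.
Qed.

(** Only the absolute values in rho prevent the transition from being rational. In the half-space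
    |rho| = rho, and on the open set [N] where the slope has the sign [c] that it has at the given
    point, its absolute value is [c] times the slope. *)
Lemma disc_smooth_transition s t :
  smooth_in_coord (chart_dom (disc_chart s) `&` chart_dom (disc_chart t))
    (disc_chart s) (disc_chart t).
Proof.
move=> p [ps pt].
pose c := Num.sg (hslope a s t (disc_chart s p)).
have glueP q : chart_dom (disc_chart s) q -> chart_dom (disc_chart t) q ->
    disc_dom s t (disc_chart s q) /\
    disc_chart t q = disc_glue a s t (disc_chart s q).
  move=> qs qt; have [s0 sE] := disc_chartP qs; have [t0 tE] := disc_chartP qt.
  have /disc_paramP[? <-] : disc_param a s (disc_chart s q) =
    disc_param a t (disc_chart t q) :> W by rewrite sE tE.
  by split=> //; rewrite habs_id.
have [dp _] := glueP p ps pt.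
pose N := (disc_dom s t : set 'rV[R]_m.+2) `&`
  (hslope a s t @^-1` [set r | 0 < c * r]).
exists N, (fun w => hcons (c * hslope a s t w * w 0 0 / hden s t w)
                          (htail (disc_glue a s t w))).
have Nd : N `<=` disc_dom s t by exact: subIsetl.
have oN : open N.
  apply: open_ratfun_preimage; [exact: open_disc_dom|exact: ratfun_hslope|].
  have : open ((fun r : R => c * r) @^-1` [set r | 0 < r]).
    apply: open_comp; last exact: open_gt.
    by move=> r _; apply: cvgM; [exact: cvg_cst|exact: cvg_id].
  by [].
split=> //.
- split=> //=; rewrite /c -normrEsg normr_gt0; exact: hslope_neq0 dp.
- apply: ratfun_smooth => [|i]; first exact: oN.
  have [j ->|->] := unliftP ord0 i.
    by under eq_fun do rewrite hconsS; exact: ratfun_htail_disc_glue.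
  by under eq_fun do rewrite hcons0; exact: ratfun_disc_glue0.
- move=> q [qs qt] [dq cq]; have [_ qE] := glueP q qs qt.
  apply: (etrans qE); have [q0 _] := disc_chartP qs.
  rewrite {1}/disc_glue [in RHS]/disc_glue htail_hcons; congr hcons.
  rewrite (ger0_norm q0) -[c * _]gtr0_norm // normrM normr_sg.
  by rewrite hslope_neq0 // mul1r.
Qed.

(** * Closed graphs, Hausdorff property and countable base *)

Lemma continuous_fst_comp (T : topologicalType) (h : 'rV[R]_m.+2 -> T) w z :
  {for w, continuous h} -> continuous_at (w, z) (fun q => h q.1).
Proof. by move=> hc; exact: (cvg_comp fst h cvg_fst hc). Qed.

Lemma continuous_snd_comp (T : topologicalType) (h : 'rV[R]_m.+2 -> T) w z :
  {for z, continuous h} -> continuous_at (w, z) (fun q => h q.2).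
Proof. by move=> hc; exact: (cvg_comp snd h cvg_snd hc). Qed.

Lemma htail_continuous k : continuous (fun w => htail w 0 k).
Proof.
rewrite (_ : (fun _ => _) = (fun w => w 0 (lift ord0 k))).
  exact: coord_continuous.
by apply/funext => w; rewrite htailE.
Qed.

Lemma hnorm_continuous : continuous (hnorm : 'rV[R]_m.+2 -> R).
Proof. by move=> w; exact: (ratfun_continuous (ratfun_hnorm setT)). Qed.

(* The [k]-th coordinate of [glue_map] depends on the earlier coordinates only
   (and on the [k]-th through a factor [x ^ (-1)] when [s] and [t] differ at [k]):
   along the graph, the product of the [k]-th coordinates of the two points is a
   Laurent monomial in the earlier ones.  Inductively this monomial survives in
   the limit as a nonzero number, so no coordinate at which [s] and [t] differ can
   tend to [0]. *)
Lemma disc_graph_closed s t w z :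
  closure [set q : 'rV[R]_m.+2 * 'rV[R]_m.+2 |
    disc_param a s q.1 = disc_param a t q.2 :> W] (w, z) ->
  disc_param a s w = disc_param a t z :> W.
Proof.
move=> wz.
have tail0 (k : 'I_m.+1) : k != l -> s k != t k -> htail w 0 k != 0.
  move: {2}(val k) (leqnn k) => K; elim/ltn_ind: K k => K ih k kK kl stk.
  (* Coordinates from [k] on are replaced by 1, so that the monomial makes sense at [w], where they
     are not yet known to be nonzero. *)
  pose pre (u : 'rV[R]_m.+2) : 'rV[R]_m.+1 :=
    \row_j if (j < k)%N then htail u 0 j else 1.
  have preE u j : pre u 0 j = if (j < k)%N then htail u 0 j else 1.
    by rewrite mxE.
  pose U := [set u | glue_dom s t (pre u)].
  have Uw : U w.
    move=> j stj; rewrite preE; case: ltnP => jk; last by rewrite oner_eq0.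
    apply: (ih j (leq_trans jk kK) j (leqnn _)) stj.
    by apply: contraTneq jk => ->; rewrite -leqNgt -ltnS ltn_ord.
  have rpre : ratfun U (fun u => glue_map a s t (pre u) 0 k).
    apply: ratfun_glue_map => [j|//].
    suff -> : (fun u => pre u 0 j) =
        if (j < k)%N then fun u => u 0 (lift ord0 j) else fun=> 1.
      by case: ifP => _; [exact: ratfun_coord|exact: ratfun_cst].
    by apply/funext => u; rewrite preE htailE; case: ifP.
  have : htail w 0 k * htail z 0 k = glue_map a s t (pre w) 0 k.
    apply: (closure_eq (f := fun q => htail q.1 0 k * htail q.2 0 k)
      (g := fun q => glue_map a s t (pre q.1) 0 k) wz).
    - apply: continuousM.
        by apply: (continuous_fst_comp (h := fun u => htail u 0 k));
          exact: htail_continuous.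
      by apply: (continuous_snd_comp (h := fun u => htail u 0 k));
          exact: htail_continuous.
    - by apply: (continuous_fst_comp (h := fun u => glue_map a s t (pre u) 0 k));
        exact: ratfun_continuous rpre Uw.
    - move=> [u v] /= /disc_paramP[[du _] vE].
      rewrite -[htail v]htail_habs vE htail_disc_glue_neq //.
      have uk : hbase u 0 k = htail u 0 k by rewrite set_coordE (negbTE kl).
      have uk0 : htail u 0 k != 0 by rewrite -uk; exact: du.
      rewrite -{1}[hbase u](set_coord_id _ k) glue_map_set_coord (negbTE stk) uk.
      rewrite exprN1 mulVKf //; apply: eq_glue_map => j jk _.
      rewrite preE !set_coordE; case: (eqVneq j k) => [->|jNk].
        by rewrite ltnn.
      have jk' : (j < k)%N by rewrite ltn_neqAle jNk.
      rewrite jk' ifN //.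
      by apply: contraTneq jk' => ->; rewrite -leqNgt -ltnS ltn_ord.
  move=> wzE; have : glue_map a s t (pre w) 0 k != 0.
    by rewrite glue_map_eq0 // (negbTE stk).
  by rewrite -wzE mulf_eq0 negb_or => /andP[].
have gw : glue_dom s t (hbase w).
  move=> j stj; rewrite set_coordE; case: (eqVneq j l) => [_|jl].
    by rewrite oner_eq0.
  exact: tail0.
have dw : disc_dom s t w.
  split=> //; rewrite /hden; case: ifP => [_|/negbT stl]; first by rewrite oner_eq0.
  pose U := [set u : 'rV[R]_m.+2 | glue_dom s t (hbase u)].
  have rs : ratfun U (hslope a s t).
    by apply: ratfun_glue_map => [j|//]; exact: ratfun_hbase.
  (* The same argument for the complex fibre coordinate: the product of the two moduli is |c|, which
     stays nonzero in the limit. *)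
  have : hnorm w * hnorm z = hslope a s t w ^+ 2.
    apply: (closure_eq (f := fun q => hnorm q.1 * hnorm q.2)
      (g := fun q => hslope a s t q.1 ^+ 2) wz).
    - apply: continuousM.
        by apply: (continuous_fst_comp (h := hnorm)); exact: hnorm_continuous.
      by apply: (continuous_snd_comp (h := hnorm)); exact: hnorm_continuous.
    - by apply: (continuous_fst_comp (h := fun u => hslope a s t u ^+ 2));
        exact: ratfun_continuous (ratfunX 2 rs) gw.
    - move=> [u v] /= /disc_paramP[[du]]; rewrite -[hnorm v]hnorm_habs /hden => + ->.
      by rewrite hnorm_disc_glue /hden (negbTE stl) => N0; field.
  move=> NE; have : hslope a s t w ^+ 2 != 0.
    by rewrite sqrf_eq0 /hslope glue_map_eq0 // (negbTE stl).
  by rewrite -NE mulf_eq0 negb_or => /andP[].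
(* Now that [w] lies in the domain, the gluing is continuous there and its equation passes to the
   limit. *)
apply/disc_paramP; split=> //; apply/rowP => i.
apply: (closure_eq (f := fun q => habs q.2 0 i)
  (g := fun q => disc_glue a s t q.1 0 i) wz).
- apply: (continuous_snd_comp (h := fun u => habs u 0 i)).
  exact: (cvg_comp habs (fun u : 'rV[R]_m.+2 => u 0 i) (habs_continuous (x := z))
    (@coord_continuous R 1 m.+2 0 i _)).
- apply: (continuous_fst_comp (h := fun u => disc_glue a s t u 0 i)).
  exact: (cvg_comp (disc_glue a s t) (fun u : 'rV[R]_m.+2 => u 0 i)
    (disc_glue_continuous dw) (@coord_continuous R 1 m.+2 0 i _)).
- by move=> [u v] /= /disc_paramP[_ ->].
Qed.

(** Parametrisations are open, so two points without disjoint neighbourhoods have parameters in the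
    closure of a gluing graph. *)
Lemma disc_hausdorff : hausdorff_space W.
Proof.
move=> p q pq; have [s [w pE]] := disc_param_surj p.
have [t [z qE]] := disc_param_surj q; rewrite pE qE.
apply: disc_graph_closed => B [[B1 B2] /= [wB1 zB2] BB].
move: wB1 zB2; rewrite !nbhsE => -[V1 [oV1 V1w] V1B] [V2 [oV2 V2z] V2B].
have n1 : nbhs p (disc_param a s @` V1).
  by apply: open_nbhs_nbhs; split; [exact: disc_param_open|exists w].
have n2 : nbhs q (disc_param a t @` V2).
  by apply: open_nbhs_nbhs; split; [exact: disc_param_open|exists z].
have [_ [[v1 Vv1 <-] [v2 Vv2 v12]]] := pq _ _ n1 n2.
exists (v1, v2); split=> //=; apply: BB; split; [exact: V1B|exact: V2B].
Qed.

Lemma disc_second_countable : @second_countable W.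
Proof.
pose B (i : {ffun 'I_m.+1 -> bool} * {ffun 'I_m.+2 -> rat * rat}) : set W :=
  disc_param a i.1 @` rat_box i.2.
exists (range B).
  exact: card_le_trans (card_image_le _ _) (countableP _).
split=> [_ [i _ <-]|p A].
  by apply: disc_param_open; exact: open_rat_box.
have [s [w ->]] := disc_param_surj p.
move=> /disc_param_continuous /rat_box_nbhs[ab abw abA].
exists (B (s, ab)); first by split; [exists (s, ab)|exists w].
by move=> _ [v vab <-]; exact: abA.
Qed.

(** * Compactness *)

Definition flip_at (k : 'I_m.+1) s : {ffun 'I_m.+1 -> bool} :=
  [ffun j => if j == k then ~~ s j else s j].

Lemma flip_atE k s j : (s j == flip_at k s j) = (j != k).
Proof. by rewrite ffunE; case: (j == k); case: (s j). Qed.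

(* Flipping [s] at [k] inverts the [k]-th coordinate (the complex one if [k = l])
   and fixes the earlier ones, so the coordinates can be brought into the unit
   ball one after the other. *)
Lemma disc_unit_box (p : W) : exists s w,
  (forall i, w 0 i \in `[-1 : R, 1]) /\ p = disc_param a s w.
Proof.
have reflip s w k : disc_dom s (flip_at k s) w ->
    disc_param a s w =
      disc_param a (flip_at k s) (disc_glue a s (flip_at k s) w) :> W /\
    forall j : 'I_m.+1, (j < k)%N ->
      htail (disc_glue a s (flip_at k s) w) 0 j = htail w 0 j.
  move=> dw; split; first by apply/disc_paramP; rewrite habs_disc_glue.
  move=> j jk; have jl : j != l.
    by apply: contraTneq jk => ->; rewrite -leqNgt -ltnS ltn_ord.
  rewrite htail_disc_glue_neq // glue_map_first => [|i ij].
    by rewrite flip_atE neq_ltn jk /= expr1z set_coordE (negbTE jl).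
  by apply/eqP; rewrite flip_atE neq_ltn (ltn_trans ij jk).
(* The induction stops before the last index, whose coordinate has to be bounded together with
   rho. *)
have boxk k : (k <= m)%N -> exists s w,
    (forall j : 'I_m.+1, (j < k)%N -> `|htail w 0 j| <= 1) /\
    p = disc_param a s w.
  elim: k => [_|k ih km].
    by have [s [w ->]] := disc_param_surj p; exists s, w.
  have [s [w [w1 ->]]] := ih (ltnW km).
  pose k' : 'I_m.+1 := widen_ord (leqnSn m) (Ordinal km).
  have kl : k' != l by rewrite neq_ltn /= km.
  have [wk|wk] := leP `|htail w 0 k'| 1.
    exists s, w; split=> // j.
    rewrite ltnS leq_eqVlt => /orP[/eqP jk|]; last exact: w1.
    by rewrite (_ : j = k') //; exact: val_inj.
  have dw : disc_dom s (flip_at k' s) w.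
    split=> [j|]; last by rewrite /hden flip_atE ifT ?oner_neq0 // eq_sym.
    rewrite flip_atE negbK => /eqP ->; rewrite set_coordE (negbTE kl).
    by rewrite -normr_gt0 (lt_trans ltr01).
  have [wE w'] := reflip _ _ _ dw.
  exists (flip_at k' s), (disc_glue a s (flip_at k' s) w); split=> // j.
  rewrite ltnS leq_eqVlt => /orP[/eqP jk|jk]; last by rewrite w' // w1.
  rewrite (_ : j = k'); last exact: val_inj.
  rewrite htail_disc_glue_neq // glue_map_first => [|i ik].
    rewrite flip_atE eqxx /= exprN1 set_coordE (negbTE kl) normfV.
    by rewrite invf_le1 ?ltW // (lt_trans ltr01).
  by apply/eqP; rewrite flip_atE neq_ltn ik.
have {boxk}[s [w [w1 ->]]] := boxk m (leqnn m).
have box z : hnorm z <= 1 ->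
    (forall j : 'I_m.+1, (j < m)%N -> `|htail z 0 j| <= 1) ->
    forall i, z 0 i \in `[-1 : R, 1].
  move=> N1 z1 i; rewrite in_itv /= -ler_norml.
  have sq1 (u v : R) : u ^+ 2 + v ^+ 2 <= 1 -> `|u| <= 1.
    move=> uv; rewrite -(@expr_le1 _ 2) // real_normK ?num_real //.
    by apply: le_trans uv; rewrite lerDl sqr_ge0.
  have [j ->|->] := unliftP ord0 i; last exact: sq1 N1.
  rewrite -htailE; have [/z1//|mj] := ltnP j m.
  rewrite (_ : j = l); first by move: N1; rewrite /hnorm addrC; exact: sq1.
  by apply/val_inj/eqP; rewrite eqn_leq mj -ltnS ltn_ord.
have [N1|N1] := leP (hnorm w) 1; first by exists s, w; split=> //; exact: box.
have dw : disc_dom s (flip_at l s) w.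
  split=> [j|].
    by rewrite flip_atE negbK => /eqP ->; rewrite set_coordE eqxx oner_eq0.
  by rewrite /hden flip_atE eqxx gt_eqF // (lt_trans ltr01).
have [wE w'] := reflip _ _ _ dw.
exists (flip_at l s), (disc_glue a s (flip_at l s) w); split=> //; apply: box => //.
  (* Only the last index is flipped, so the slope is 1 and the squared modulus N > 1 becomes N / N^2
     = 1 / N. *)
  rewrite hnorm_disc_glue /hslope glue_map_first => [|i il]; last first.
    by apply/eqP; rewrite flip_atE neq_ltn il.
  rewrite set_coordE eqxx exp1rz expr1n mul1r /hden flip_atE eqxx /=.
  rewrite expr2 invfM mulrA divff ?mul1r ?invf_le1 ?ltW ?gt_eqF //;
  exact: lt_trans ltr01 N1.
by move=> j jm; rewrite w' // w1.
Qed.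

Lemma disc_compact : compact [set: W].
Proof.
have -> : [set: W] = \big[setU/set0]_(s : {ffun 'I_m.+1 -> bool})
    (disc_param a s @` [set w : 'rV[R]_m.+2 | forall i, w 0 i \in `[-1, 1]]).
  apply/seteqP; split=> // p _; have [s [w [w1 ->]]] := disc_unit_box p.
  by rewrite (bigD1 s) //=; left; exists w.
apply: bigsetU_compact => s _; apply: continuous_compact.
  exact/continuous_subspaceT/disc_param_continuous.
apply: (@rV_compact R _ (fun=> `[-1, 1]%classic)).
by move=> _; apply: segment_compact.
Qed.

Lemma disc_smooth_manifold : smooth_manifold_with_boundary disc_manifold.
Proof.
split.
- exact: disc_hausdorff.
- exact: disc_second_countable.
- move=> p; have [s [w ->]] := disc_param_surj p.
  by exists (disc_chart s); [exists s|exists w].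
- by move=> _ [s _ <-]; exact: open_disc_chart_dom.
- by move=> _ [s _ <-]; exact: disc_chart_continuous.
- move=> _ [s _ <-] p q /disc_chartP[_ pE] /disc_chartP[_ qE] pq.
  by rewrite -pE -qE pq.
- by move=> _ [s _ <-]; exact: disc_chart_open_map.
- by move=> _ _ [s _ <-] [t _ <-]; exact: disc_smooth_transition.
Qed.

End DiscManifold.

(** * Identification of the boundary with the real Bott manifold *)

Section BoundaryDiffeomorphism.
Context {R : realType} {m : nat} (a : 'M[int]_m.+1).
Implicit Types (s t r : {ffun 'I_m.+1 -> bool}) (x y : 'rV[R]_m.+1).
Let l : 'I_m.+1 := ord_max.
Local Notation Y := (real_bott_space R a).
Local Notation W := (disc_space (R := R) a).
Local Notation bW := (boundary (disc_manifold (R := R) a)).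

Lemma real_bott_paramP s t x y :
  real_bott_param a s x = real_bott_param a t y :> Y <->
  glue_dom s t x /\ y = glue_map a s t x.
Proof.
have eqP := @eqmodP _ (@glued_equiv R m.+1 a) (piece s x) (piece t y).
split=> [h|h]; first by have /eqP/asboolP := h.
exact/eqP/asboolP.
Qed.

Lemma real_bott_param_surj (p : Y) : exists s x, p = real_bott_param a s x.
Proof.
case E : (repr p) => [s x]; exists s, x; rewrite /real_bott_param /piece -E.
by rewrite reprK.
Qed.

Lemma real_bott_param_continuous s :
  continuous (real_bott_param a s : 'rV[R]_m.+1 -> Y).
Proof.
move=> x; apply: (@continuous_comp _ _ _ (piece s)).
  exact: existT_continuous.
exact: pi_continuous.
Qed.

Lemma real_bott_chart_param s x : real_bott_chart R a s (real_bott_param a s x) = x.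
Proof.
apply: xget_subset1 => // y z yE zE.
have /real_bott_paramP[_ ->] : real_bott_param a s y = real_bott_param a s z :> Y.
  by rewrite yE zE.
by rewrite glue_map_refl.
Qed.

Lemma smooth_glue_map s t :
  smooth_on (glue_dom s t) (glue_map a s t : 'rV[R]_m.+1 -> 'rV[R]_m.+1).
Proof.
apply: ratfun_smooth => [|j]; first exact: open_glue_dom.
by apply: (@ratfun_glue_map _ _ a s t _ _ id j) => // i; exact: ratfun_coord.
Qed.

(** At rho = 0 the squared modulus is x_l^2, and c x_l / x_l^2 = c / x_l is the original
    inversion. *)
Lemma disc_glue_hcons0 s t x : glue_dom s t x ->
  disc_dom s t (hcons 0 x) /\
  disc_glue a s t (hcons 0 x) = hcons 0 (glue_map a s t x).
Proof.
move=> dx; have bx : hbase (hcons 0 x) = set_coord 1 l x.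
  by rewrite /hbase htail_hcons.
have nx : hnorm (hcons 0 x) = x 0 l ^+ 2.
  by rewrite /hnorm hcons0 htail_hcons expr0n add0r.
split.
  split=> [j st|].
    by rewrite bx set_coordE; case: (j =P l) => _; [rewrite oner_eq0|exact: dx].
  rewrite /hden nx; case: ifP => [_|/negbT st]; first by rewrite oner_eq0.
  by rewrite expf_neq0 //; exact: dx.
rewrite /disc_glue hcons0 normr0 mulr0 mul0r htail_hcons; congr hcons.
apply/rowP => j; rewrite set_coordE; case: eqVneq => [->|jl].
  rewrite -[x in RHS](set_coord_id _ l) glue_map_set_coord /hslope bx /hden nx.
  case: ifP => [_|/negbT st]; first by rewrite expr1z divr1 mulrC.
  by have x0 := dx l st; rewrite exprN1; field.
rewrite bx; apply: eq_glue_map => i ij _; rewrite set_coordE ifN //.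
apply: contra_neq jl => il; apply/val_inj/eqP.
by rewrite /= eqn_leq -ltnS ltn_ord -[X in (X <= _)%N](congr1 val il).
Qed.

(** One direction makes x -> (0, x) well defined on Y, the other makes it injective. *)
Lemma disc_param_hcons0 s t x y :
  disc_param a s (hcons 0 x) = disc_param a t (hcons 0 y) :> W <->
  real_bott_param a s x = real_bott_param a t y :> Y.
Proof.
split=> [/disc_paramP[[dx N0] yE]|/real_bott_paramP[dx ->]]; last first.
  have [? gE] := disc_glue_hcons0 dx; apply/disc_paramP; split=> //.
  by rewrite gE habs_id // /half_space /= hcons0.
have dx' : glue_dom s t x.
  move=> j st; have := dx j st; rewrite set_coordE htail_hcons.
  case: (j =P l) => // jl _; move: st N0; rewrite jl /hden => st; rewrite ifN //.
  by rewrite /hnorm hcons0 htail_hcons expr0n add0r sqrf_eq0.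
apply/real_bott_paramP; split=> //.
have [_ gE] := disc_glue_hcons0 dx'.
by rewrite -[y](htail_hcons 0) -htail_habs yE gE htail_hcons.
Qed.

Definition bott_in_disc (p : Y) : W :=
  disc_param a (projT1 (repr p)) (hcons 0 (projT2 (repr p))).

Lemma bott_in_disc_param s x :
  bott_in_disc (real_bott_param a s x) = disc_param a s (hcons 0 x).
Proof.
apply/disc_param_hcons0; rewrite -[RHS]reprK /real_bott_param /piece.
by case: (repr _).
Qed.

Lemma bott_in_disc_inj : injective bott_in_disc.
Proof.
move=> p q; have [s [x ->]] := real_bott_param_surj p.
have [t [y ->]] := real_bott_param_surj q.
by rewrite !bott_in_disc_param => /disc_param_hcons0.
Qed.

Lemma bott_in_disc_continuous : continuous bott_in_disc.
Proof.
apply/quotient_continuous => -[s x].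
suff : {for x, continuous (bott_in_disc \o real_bott_param a s)} by [].
rewrite (_ : _ \o _ = (disc_param a s \o hcons 0 : _ -> W)); last first.
  by apply/funext => y; exact: bott_in_disc_param.
apply: continuous_comp; last exact: disc_param_continuous.
apply: continuous_rV => i; have [j ->|->] := unliftP ord0 i.
  by under eq_fun do rewrite hconsS; exact: coord_continuous.
by under eq_fun do rewrite hcons0; exact: cst_continuous.
Qed.

Lemma disc_boundaryP (p : W) :
  boundary_set (W := disc_manifold a) p <-> range bott_in_disc p.
Proof.
split=> [[_ [s _ <-] [sp p0]]|[q _ <-]].
  have [_ pE] := disc_chartP sp.
  exists (real_bott_param a s (htail (disc_chart a s p))) => //.
  by rewrite bott_in_disc_param -[in LHS]p0 hcons_htail.
have [s [x ->]] := real_bott_param_surj q; rewrite bott_in_disc_param.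
exists (disc_chart a s); first by exists s.
by split; [exists (hcons 0 x)|rewrite disc_chart_param habs0 hcons0 normr0].
Qed.

(** Every gluing multiplies |rho| by a factor, so a boundary point has rho = 0 in each chart
    containing it, not just in one. *)
Lemma bott_disc_chart (q : Y) s : chart_dom (disc_chart a s) (bott_in_disc q) ->
  q = real_bott_param a s (htail (disc_chart a s (bott_in_disc q))).
Proof.
have [t [x ->]] := real_bott_param_surj q; rewrite bott_in_disc_param.
set p := disc_param a t _ => /disc_chartP[_ pE]; set w := disc_chart a s p.
have /disc_paramP[_ wE] : disc_param a t (hcons 0 x) = disc_param a s w :> W.
  by rewrite pE.
have w0 : w 0 0 = 0.
  by apply/normr0_eq0; rewrite -habs0 wE disc_glue0 hcons0 normr0 mulr0 mul0r.
apply: bott_in_disc_inj; rewrite !bott_in_disc_param; apply: (etrans (esym pE)).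
by rewrite -/w -{1}[w]hcons_htail w0.
Qed.

Definition to_boundary (p : Y) : bW :=
  exist _ (bott_in_disc p)
    (mem_set ((disc_boundaryP (bott_in_disc p)).2 (imageT bott_in_disc p))).

(** The default of [xget] is never returned, because every boundary point is in the range of
    [bott_in_disc]. *)
Definition of_boundary (p : bW) : Y :=
  xget (real_bott_param a [ffun=> false] 0) [set q | bott_in_disc q = val p].

Lemma bott_in_disc_of_boundary p : bott_in_disc (of_boundary p) = val p.
Proof.
have /set_mem/disc_boundaryP[q _ qE] := valP p.
by rewrite /of_boundary; case: xgetP => [_ -> //|/(_ q)]; rewrite /= qE.
Qed.

Lemma to_boundaryK : cancel to_boundary of_boundary.
Proof.
by move=> p; apply: bott_in_disc_inj; rewrite bott_in_disc_of_boundary.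
Qed.

Lemma of_boundaryK : cancel of_boundary to_boundary.
Proof. by move=> p; apply: val_inj; exact: bott_in_disc_of_boundary. Qed.

(** In the charts of [s] and [t] the map is [glue_map a s t] itself, since a boundary chart just
    forgets rho. *)
Lemma to_boundary_smooth :
  smooth_map (X := real_bott_manifold R a) (Y := bW) to_boundary.
Proof.
split.
  apply/continuousP => _ [V oV <-].
  apply: (@open_comp _ _ bott_in_disc V) => // p _; exact: bott_in_disc_continuous.
move=> _ _ [s _ <-] [_ [t _ <-] <-].
have domE q : chart_dom (real_bott_chart R a s) q ->
    chart_dom (disc_chart a t) (bott_in_disc q) ->
    glue_dom s t (real_bott_chart R a s q) /\
    htail (disc_chart a t (bott_in_disc q)) =
      glue_map a s t (real_bott_chart R a s q).
  move=> [x _ <-] /bott_disc_chart; rewrite real_bott_chart_param.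
  by move=> /real_bott_paramP.
move=> p [sp tp]; exists (glue_dom s t); exists (glue_map a s t).
have [dp _] := domE p sp tp.
split=> //; [exact: open_glue_dom|exact: smooth_glue_map|].
by move=> q [sq tq] _; have [_ <-] := domE q sq tq.
Qed.

Lemma of_boundary_smooth :
  smooth_map (X := bW) (Y := real_bott_manifold R a) of_boundary.
Proof.
have chartE (p : bW) s : chart_dom (disc_chart a s) (val p) ->
    of_boundary p = real_bott_param a s (htail (disc_chart a s (val p))).
  by rewrite -bott_in_disc_of_boundary => /bott_disc_chart.
split.
  move=> p; have [s [x pE]] := disc_param_surj (val p).
  have sp : chart_dom (disc_chart a s) (val p) by rewrite pE; exists x.
  have val_cont : continuous (val : bW -> W) by exact: initial_continuous.
  (* Continuity is local: near [p] the inverse coincides with this composite of continuous maps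
     through a single chart. *)
  pose h (q : bW) : Y := real_bott_param a s (htail (disc_chart a s (val q))).
  have hc : {for p, continuous h}.
    have c1 := continuous_comp (val_cont p) (disc_chart_continuous sp).
    have c2 : continuous (htail : 'rV[R]_m.+2 -> 'rV[R]_m.+1).
      by move=> w; apply: continuous_rV => k; exact: htail_continuous.
    have c3 := @real_bott_param_continuous s.
    exact: continuous_comp (continuous_comp c1 (c2 _)) (c3 _).
  have ph : \forall q \near p, h q = of_boundary q.
    have : nbhs (val p) (chart_dom (disc_chart a s)).
      by apply: open_nbhs_nbhs; split=> //; exact: open_disc_chart_dom.
    by move=> /val_cont; apply: (@filterS _ (nbhs p)) => q /chartE.
  rewrite /prop_for /continuous_at (chartE p s) // -/(h p).
  exact: cvg_trans (near_eq_cvg ph) hc.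
move=> _ _ [_ [s _ <-] <-] [t _ <-].
have domE (q : bW) : chart_dom (disc_chart a s) (val q) ->
    chart_dom (real_bott_chart R a t) (of_boundary q) ->
    glue_dom s t (htail (disc_chart a s (val q))) /\
    real_bott_chart R a t (of_boundary q) =
      glue_map a s t (htail (disc_chart a s (val q))).
  move=> sq [x _ xE]; rewrite -xE real_bott_chart_param.
  by apply/real_bott_paramP; rewrite -chartE.
move=> p [sp tp]; exists (glue_dom s t); exists (glue_map a s t).
have [dp _] := domE p sp tp.
split=> //; [exact: open_glue_dom|exact: smooth_glue_map|].
by move=> q [sq tq] _; have [_ <-] := domE q sq tq.
Qed.

End BoundaryDiffeomorphism.

Theorem theorem5p5 (R : realType) (n : nat) (n_ge1 : (1 <= n)%N)
    (C : 'M['F_2]_n) (C_bott : bott_matrix C)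
    (a : 'M[int]_n) (a_lift : integral_lift C a) :
  null_cobordant (real_bott_manifold R a).
Proof.
(* Writing n = m + 1 provides the last coordinate; for n = 0 the space would be a single point,
   which is not the boundary of a compact 1-manifold. *)
case: n n_ge1 a {C C_bott a_lift} => // m _ a.
exists (disc_manifold a); split.
- exact: disc_smooth_manifold.
- exact: disc_compact.
- exists (to_boundary (a := a)), (of_boundary (a := a)); split.
  + exact: to_boundaryK.
  + exact: of_boundaryK.
  + exact: to_boundary_smooth.
  + exact: of_boundary_smooth.
Qed.
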